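(* Let $K$ be a nonempty compact metric space and let $(\Phi,\|\cdot\|_\infty)$ be a closed Banach subspace of $(C(K),\|\cdot\|_\infty)$ which separates the points of $K$ and contains the constants. Then the set $\Phi\mathrm{Exp}(K)$ is a norming subset for $\Phi$, and $$\partial\Phi=\overline{\Phi\mathrm{Exp}(K)}=\overline{Ch(\Phi)}.$$
   Context: $(C(K),\|\cdot\|_\infty)$ is the Banach space of real-valued continuous functions on $K$ with the sup-norm. A point $k\in K$ is $\Phi$-exposed if there is $\varphi\in\Phi$ with $\varphi(k)>\varphi(y)$ for all $y\in K\setminus\{k\}$; $\Phi\mathrm{Exp}(K)$ is the set of such points. A subset $L\subseteq K$ is norming for $\Phi$ if $\|\varphi\|_\infty=\sup_{x\in L}|\varphi(x)|$ for every $\varphi\in\Phi$. A boundary for $\Phi$ is a subset $C\subseteq K$ such that $\|\varphi\|_\infty=\max_{x\in C}|\varphi(x)|$ for every $\varphi\in\Phi$. The Choquet boundary $Ch(\Phi)$ is the set of all $x\in K$ such that the evaluation $\delta_x:\varphi\mapsto\varphi(x)$ is an extreme point of the closed unit ball of $\Phi^*$. The Shilov boundary $\partial\Phi$ is the unique minimal (for inclusion) closed boundary for $\Phi$; its existence under the present hypotheses is a theorem of D. P. Milman. Bars denote closures in $K$. *)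

(* Defs.v *)
From HB Require Import structures.
From mathcomp Require Import all_boot all_order all_algebra.
From mathcomp Require Import all_classical all_reals all_analysis.

Set Implicit Arguments.
Unset Strict Implicit.
Unset Printing Implicit Defensive.

Import Order.TTheory GRing.Theory Num.Theory.
Import numFieldNormedType.Exports.

Local Open Scope classical_set_scope.
Local Open Scope ring_scope.

Section Definitions.
Context {R : realType} {K : metricType R}.
Implicit Types (Phi : set (K -> R)) (C L S : set K).

(* [sup] is the supremum of a set of reals; it is only meaningful here because
   [K] is nonempty and compact and [f] is continuous. *)
Definition sup_norm (f : K -> R) : R := sup [set `|f x| | x in [set: K]].

Definition linear_subspace Phi : Prop :=
  Phi (cst 0) /\
  forall (a : R) (f g : K -> R), Phi f -> Phi g -> Phi (fun x => a * f x + g x).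

(* Closedness is taken in the space of all functions with the topology of
   uniform convergence. Since uniform limits of continuous functions are
   continuous, a set of continuous functions is closed there iff it is closed
   in (C(K), sup-norm). *)
Definition closed_subspace_of_CK Phi : Prop :=
  [/\ Phi `<=` [set f : K -> R | continuous f],
      linear_subspace Phi &
      closed (Phi : set {uniform K -> R})].

Definition separates_points Phi : Prop :=
  forall x y : K, x <> y -> exists2 f, Phi f & f x <> f y.

Definition contains_constants Phi : Prop := forall c : R, Phi (cst c).

Definition exposed Phi : set K :=
  [set k | exists2 f, Phi f & forall y, y <> k -> f y < f k].

Definition norming Phi L : Prop :=
  forall f, Phi f -> sup_norm f = sup [set `|f x| | x in L].

(* The two conjuncts say that [sup_norm f] is the maximum of |f| over [C]. *)
Definition boundary Phi C : Prop :=
  forall f, Phi f ->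
    [set `|f x| | x in C] (sup_norm f) /\
    ubound [set `|f x| | x in C] (sup_norm f).

Definition minimal_closed_boundary Phi S : Prop :=
  [/\ closed S, boundary Phi S &
      forall C, closed C -> boundary Phi C -> C `<=` S -> C = S].

Definition Shilov_boundary Phi S : Prop :=
  minimal_closed_boundary Phi S /\
  forall C, minimal_closed_boundary Phi C -> C = S.

(* The elements of the dual are functions on the subtype [set_type Phi], so that
   functionals are compared only through their values on [Phi]. The subtype
   carries no algebraic structure, hence linearity is stated through the
   underlying functions on [K]. *)
Definition dual Phi : set (set_type Phi -> R^o) :=
  [set l |
    (forall (a : R) (f g h : set_type Phi),
       (forall x, val h x = a * val f x + val g x) ->
       l h = a * l f + l g) /\
    exists M : R, forall f : set_type Phi, `|l f| <= M * sup_norm (val f)].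

Definition dual_norm Phi (l : set_type Phi -> R^o) : R :=
  sup [set `|l f| | f in [set f : set_type Phi | sup_norm (val f) <= 1]].

Definition dual_unit_ball Phi : set (set_type Phi -> R^o) :=
  [set l | dual l /\ dual_norm l <= 1].

Definition eval_at Phi (x : K) : set_type Phi -> R^o := fun f => val f x.

End Definitions.

Definition extreme_point {R : realType} {E : lmodType R} (A : set E) : set E :=
  [set p | A p /\
    forall (t : R) (u v : E), 0 < t < 1 -> A u -> A v ->
      p = t *: u + (1 - t) *: v -> u = p /\ v = p].

Definition Choquet_boundary {R : realType} {K : metricType R}
    (Phi : set (K -> R)) : set K :=
  [set x | extreme_point (@dual_unit_ball R K Phi) (@eval_at R K Phi x)].

(* Main.v *)
Require Import Defs.
From HB Require Import structures.
From mathcomp Require Import all_boot all_order all_algebra.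
From mathcomp Require Import all_classical all_reals all_analysis.
From mathcomp Require Import lra.

Set Implicit Arguments.
Unset Strict Implicit.
Unset Printing Implicit Defensive.

Import Order.TTheory GRing.Theory Num.Theory.
Import numFieldNormedType.Exports.

Local Open Scope classical_set_scope.
Local Open Scope ring_scope.

(** Maxima. Every f in Phi is a uniform limit of functions of Phi that attain
    their maximum at a single point ([exposing_dense]), so a bound of f on the
    exposed points is a bound of f on K ([exposed_dominates]); applied to f and
    to its opposite, this says that the exposed points are norming. The
    approximation shrinks balls in Phi: the points that nearly maximize the
    centre of a ball, up to twice its radius, include the maximizers of all its
    members, and become fewer in a smaller ball. Moving the centre from f to
    f + t h with t small makes h nearly constant on the near-maximizers, since
    its values there must be close to its maximum over the maximizers of f
    ([generic_flat]). As Phi separates points and K is compact, finitely many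
    such moves force the near-maximizers to be close to each other
    ([generic_ball]); a sequence of balls achieving this at every scale has a
    common point, which lies in Phi because Phi is uniformly closed.

    Shilov boundary. A function exposing k, shifted by a constant to be
    nonnegative, attains its norm at k only; so every boundary contains the
    exposed points, and their closure is the least closed boundary.

    Choquet boundary. If f exposes k and the evaluation at k is a proper convex
    combination of two functionals of norm at most 1, both are positive, equal
    to 1 at the constant 1, and agree with the evaluation at f; the estimate
    g <= g k + e + c (f k - f) ([peak_envelope]) then forces agreement at every
    g. Conversely, take x in the Choquet boundary. Say that a set A dominates x
    when every bound on A of a function of Phi is a bound at x. When the union
    of A and B dominates x, the Hahn-Banach theorem splits the evaluation at x
    into a convex combination of functionals dominated by A and by B
    ([dominates_split]); by extremality, A or B alone dominates x
    ([Choquet_dominates_prime]). Since the exposed points dominate x, the sets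
    without which they would no longer do so form a proper filter; it clusters
    somewhere in K, necessarily at x, and necessarily in the closure of the
    exposed points. *)

(** * Linear functionals below a convex cone *)

Section LinearMinorants.
Context {R : realType} {V : lmodType R}.
Implicit Types (C : set (V * R^o)) (D : set V).

(** The convex cones of pairs (v, r), read as constraints l v <= r on an unknown
    linear functional l; the last clause says that they are not contradictory.
    The epigraph of a sublinear function is an example, but cones spare the
    infima that sublinear functions would require. *)
Definition epigraph_cone C : Prop :=
  [/\ C 0, forall p q, C p -> C q -> C (p + q),
      forall (s : R) p, 0 < s -> C p -> C (s *: p) &
      forall r, C (0, r) -> 0 <= r].

Lemma epigraph_cone_scale C s p :
  epigraph_cone C -> 0 <= s -> C p -> C (s *: p).
Proof.
move=> [C0 _ CZ _]; rewrite le_eqVlt => /predU1P[<- _|]; last exact: CZ.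
by rewrite scale0r.
Qed.

Lemma maximal_epigraph_cone C : epigraph_cone C ->
  exists M, [/\ epigraph_cone M, C `<=` M &
    forall N, epigraph_cone N -> M `<=` N -> N `<=` M].
Proof.
move=> coneC.
have chainP F : F `<=` [set A | epigraph_cone (C `|` A)] -> total_on F subset ->
    epigraph_cone (C `|` \bigcup_(X in F) X).
  move=> Fcone Ftot.
  (* two points of the union lie in a single cone; X is set0 if both are in C *)
  have chain p q : (C `|` \bigcup_(X in F) X) p -> (C `|` \bigcup_(X in F) X) q ->
      exists X, [/\ epigraph_cone (C `|` X),
        X `<=` \bigcup_(X in F) X, (C `|` X) p & (C `|` X) q].
    case=> [Cp|[X FX Xp]] [Cq|[Y FY Yq]].
    - exists set0; split; [by rewrite setU0|exact: sub0set|by left|by left].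
    - exists Y; split; [exact: Fcone|exact: bigcup_sup|by left|by right].
    - exists X; split; [exact: Fcone|exact: bigcup_sup|by right|by left].
    - have [XY|YX] := Ftot _ _ FX FY.
      + exists Y; split; [exact: Fcone|exact: bigcup_sup|right; exact: XY|by right].
      + exists X; split; [exact: Fcone|exact: bigcup_sup|by right|right; exact: YX].
  split.
  - by left; case: coneC.
  - move=> p q Fp Fq; have [X [[_ XD _ _] XF Xp Xq]] := chain _ _ Fp Fq.
    exact: (setUS XF) (XD _ _ Xp Xq).
  - move=> s p s0 Fp; have [X [[_ _ XZ _] XF Xp _]] := chain _ _ Fp Fp.
    exact: (setUS XF) (XZ _ _ s0 Xp).
  - move=> r Fr; have [X [[_ _ _ XP] _ Xp _]] := chain _ _ Fr Fr.
    exact: XP.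
have [A [coneA Amax]] := Zorn_bigcup chainP.
exists (C `|` A); split => // N coneN MN.
have CN : C `|` N = N by apply/setUidPr => p Cp; apply: MN; left.
apply: contrapT => NM; apply: (Amax N); last by rewrite /= CN.
split => [p Ap|NA]; first by apply: MN; right.
by apply: NM => p /NA; right.
Qed.

(** The best upper bound that the constraints in M impose on the value at w. *)
Definition height M (w : V) : R := inf [set r | M (w, r)].

Lemma epigraph_cone_opp M w a b :
  epigraph_cone M -> M (w, a) -> M (- w, b) -> 0 <= a + b.
Proof.
move=> [_ MD _ Mpos] Ma Mb; apply: Mpos.
have -> : (0, a + b) = (w, a) + (- w, b) :> V * R^o.
  by congr pair; rewrite addrN.
exact: MD.
Qed.

Lemma height_le M w r r' : epigraph_cone M -> M (w, r) -> M (- w, r') ->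
  height M w <= r.
Proof.
move=> coneM Mwr Mwr'; apply: ge_inf => //; exists (- r') => s Ms.
by rewrite -subr_ge0 opprK; apply: epigraph_cone_opp coneM Ms Mwr'.
Qed.

(** Requiring l w >= height M w never contradicts M, because M implies no upper
    bound at w below [height M w]; a maximal cone contains that constraint. *)
Lemma maximal_epigraph_cone_height M (w : V) : epigraph_cone M ->
  (forall N, epigraph_cone N -> M `<=` N -> N `<=` M) ->
  (exists r, M (- w, r)) -> M (- w, - height M w).
Proof.
move=> coneM Mmax [r' Mwr']; have [M0 MD MZ Mpos] := coneM.
(* the cone generated by M and (- w, - height M w) *)
pose N := [set p | exists2 s, 0 <= s &
  M (p + s *: ((w, height M w) : V * R^o))].
apply: (Mmax N).
- split.
  + by exists 0; rewrite ?scale0r ?addr0.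
  + move=> p q [s s0 Mp] [t t0 Mq]; exists (s + t); first exact: addr_ge0.
    by rewrite scalerDl addrACA; exact: MD.
  + move=> s p s0 [t t0 Mp]; exists (s * t).
      by rewrite mulr_ge0// ltW.
    by rewrite -scalerA -scalerDr; exact: MZ.
  + move=> q [s]; rewrite le_eqVlt => /predU1P[<-|s0].
      by rewrite scale0r addr0 => /Mpos.
    move=> /(MZ s^-1); rewrite invr_gt0 => /(_ s0).
    rewrite scalerDr scalerA mulVf ?gt_eqF// scale1r => Mq.
    have Mwq : M (w, s^-1 * q + height M w).
      have -> : (w, s^-1 * q + height M w) =
          s^-1 *: ((0, q) : V * R^o) + (w, height M w).
        by congr pair; rewrite /= scaler0 add0r.
      exact: Mq.
    have := height_le coneM Mwq Mwr'.
    by rewrite lerDr pmulr_rge0// invr_gt0.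
- by move=> p Mp; exists 0; rewrite ?scale0r ?addr0.
- exists 1; rewrite // scale1r.
  suff -> : (- w, - height M w) + (w, height M w) = 0 :> V * R^o by [].
  by congr pair; rewrite /= addNr.
Qed.

(** A maximal cone prescribes the value at w exactly. *)
Lemma maximal_epigraph_cone_line M (w : V) : epigraph_cone M ->
  (forall N, epigraph_cone N -> M `<=` N -> N `<=` M) ->
  (exists r, M (w, r)) -> (exists r, M (- w, r)) ->
  exists a : R, M (w, a) /\ M (- w, - a).
Proof.
move=> coneM Mmax Mw MNw; exists (height M w).
have MN := maximal_epigraph_cone_height coneM Mmax MNw; split => //.
have := maximal_epigraph_cone_height (w := - w) coneM Mmax.
rewrite opprK => /(_ Mw) Mp.
suff <- : - height M (- w) = height M w by [].
apply/eqP; rewrite eq_le; apply/andP; split; last exact: height_le Mp MN.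
rewrite lerNl; apply: lb_le_inf => // r Mr; rewrite lerNl.
apply: lb_le_inf => // s Ms; rewrite lerNl -subr_ge0 opprK addrC.
exact: epigraph_cone_opp coneM Ms Mr.
Qed.

(** The Hahn-Banach theorem, in a form that takes the constraints as they come.
    In a maximal cone the pairs (v, a) lying there together with their opposites
    form a linear subspace of the product, which is the graph of the functional.
    The subspace D enters as a predicate so that the theorem applies to a set of
    functions. *)
Theorem linear_minorant C D : epigraph_cone C ->
  (forall (a : R) v w, D v -> D w -> D (a *: v + w)) ->
  (forall v, D v -> exists r, C (v, r)) ->
  exists l : V -> R,
    (forall (a : R) v w, D v -> D w -> l (a *: v + w) = a * l v + l w) /\
    (forall v r, D v -> C (v, r) -> l v <= r).
Proof.
move=> coneC DL DC.
have [M [coneM CM Mmax]] := maximal_epigraph_cone coneC.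
have DN v : D v -> D (- v).
  move=> Dv; have D0 : D 0 by rewrite -(addNr v) -scaleN1r; exact: DL.
  by rewrite -[- v]addr0 -scaleN1r; exact: DL.
have line v : exists a : R, D v -> M (v, a) /\ M (- v, - a).
  have [Dv|nDv] := pselect (D v); last by exists 0.
  have [a Ma] : exists a : R, M (v, a) /\ M (- v, - a).
    apply: maximal_epigraph_cone_line coneM Mmax _ _.
      by have [r /CM] := DC _ Dv; exists r.
    by have [r /CM] := DC _ (DN _ Dv); exists r.
  by exists a.
have [l lP] := choice line; exists l.
have [M0 MD MZ Mpos] := coneM.
split=> [a v w Dv Dw|v r Dv /CM Mr]; last first.
  by rewrite -subr_ge0; apply: epigraph_cone_opp coneM Mr (lP _ Dv).2.
have MS b v' : D v' -> M (b *: v', b * l v').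
  move=> /lP[Mp Mn]; have [b0|b0] := leP 0 b.
    exact: epigraph_cone_scale coneM b0 Mp.
  have := MZ (- b) _ _ Mn; rewrite oppr_gt0 => /(_ b0).
  suff -> : - b *: ((- v', - l v') : V * R^o) = (b *: v', b * l v') by [].
  by congr pair; rewrite /= ?scalerN ?scaleNr ?opprK// mulrNN.
have [Mv Mw] := (MS a v Dv, lP _ Dw).
have [Mvw MNvw] := lP _ (DL a _ _ Dv Dw).
apply/eqP; rewrite eq_le -subr_ge0 -[X in _ && X]subr_ge0; apply/andP; split.
  exact: epigraph_cone_opp coneM (MD _ _ Mv Mw.1) MNvw.
rewrite opprD addrC.
suff M' : M (- (a *: v + w), - (a * l v) - l w).
  by rewrite addrC; exact: epigraph_cone_opp coneM Mvw M'.
have := MD _ _ (MS (- a) v Dv) Mw.2.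
suff -> : (- a *: v, - a * l v) + (- w, - l w) =
  (- (a *: v + w), - (a * l v) - l w) :> V * R^o by [].
by congr pair; rewrite /= ?opprD ?scaleNr ?mulNr.
Qed.

End LinearMinorants.

(** * Continuous functions on a compact space *)

Section CompactFunctions.
Context {R : realType} {K : metricType R}.
Context (K_nonempty : [set: K] !=set0) (K_compact : compact [set: K]).
Implicit Types (f g h : K -> R) (A : set K).

Lemma closed_superlevel f c : continuous f -> closed [set x | c <= f x].
Proof. by move=> cf; apply: (continuous_closedP f).1 (@closed_ge R c). Qed.

Lemma continuous_argmax f A : continuous f -> A !=set0 -> closed A ->
  exists2 z, A z & forall x, A x -> f x <= f z.
Proof.
move=> cf A0 Acl.
have Ac : compact A by exact: subclosed_compact Acl K_compact _.
have [z zA zmax] := compact_EVT_max A0 Ac (continuous_subspaceT cf).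
by exists z => [|x Ax]; [exact: set_mem|apply: zmax; exact: mem_set].
Qed.

Lemma continuous_max f : continuous f -> exists z, forall x, f x <= f z.
Proof.
move=> cf; have [z _ zmax] := continuous_argmax cf K_nonempty closedT.
by exists z => x; exact: zmax.
Qed.

Lemma has_ubound_abs f A : continuous f -> has_ubound [set `|f x| | x in A].
Proof.
move=> cf; have [z zmax] : exists z, forall x, `|f x| <= `|f z|.
  apply: (@continuous_max (fun x => `|f x|)) => x.
  exact/continuous_comp/norm_continuous/cf.
by exists `|f z| => _ [x _ <-].
Qed.

Lemma abs_le_sup_norm f x : continuous f -> `|f x| <= sup_norm f.
Proof. by move=> cf; apply: ub_le_sup; [exact: has_ubound_abs|exists x]. Qed.

End CompactFunctions.

(** * Functions with a single maximum *)

Section FunctionSpace.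
Context {R : realType} {K : metricType R} (Phi : set (K -> R)).
Context (K_nonempty : [set: K] !=set0) (K_compact : compact [set: K]).
Context (Phi_closed_subspace : closed_subspace_of_CK Phi).
Context (Phi_separates : separates_points Phi).
Context (Phi_constants : contains_constants Phi).
Implicit Types (f g h : K -> R) (P Q : set (K * K)).

Lemma Phi_continuous f : Phi f -> continuous f.
Proof. by case: Phi_closed_subspace => sub _ _ /sub. Qed.

Lemma Phi_linear (a : R) f g : Phi f -> Phi g -> Phi (fun x => a * f x + g x).
Proof. by case: Phi_closed_subspace => _ [_ lin] _; exact: lin. Qed.

Lemma Phi_scale (a : R) f : Phi f -> Phi (fun x => a * f x).
Proof.
move=> Pf; have := Phi_linear a Pf (Phi_constants 0).
by under [fun x => _ + _]eq_fun do rewrite addr0.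
Qed.

Lemma Phi_opp f : Phi f -> Phi (fun x => - f x).
Proof. by move/(Phi_scale (-1)); under eq_fun do rewrite mulN1r. Qed.

Lemma Phi_uniform_limit g :
  (forall e : R, 0 < e -> exists2 f, Phi f & forall x, `|g x - f x| <= e) ->
  Phi g.
Proof.
move=> lim; have [_ _ clPhi] := Phi_closed_subspace.
apply: clPhi => B /uniform_nbhs[E [+ EB]].
rewrite -entourage_ballE => -[e /= e0 subE].
have [f Pf fg] := lim (e / 2) (divr_gt0 e0 (ltr0n _ 2)).
exists f; split => //; apply: EB => y _; apply: subE => /=.
rewrite /ball /=; apply: le_lt_trans (fg y) _; lra.
Qed.

(** A function at uniform distance at most e from f attains its maximum only at
    points of [near_max f e]. *)
Definition near_max f (e : R) : set K := [set x | forall y, f y <= f x + 2 * e].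

(** The ball of centre g and radius d lies in the ball of centre f and
    radius e. *)
Definition subball f (e : R) g (d : R) : Prop :=
  [/\ Phi g, 0 < d & forall x, `|g x - f x| <= e - d].

Lemma subball_near_max f e g d :
  subball f e g d -> near_max g d `<=` near_max f e.
Proof.
move=> [_ _ fg] x gx y; have := gx y; have := fg x; have := fg y.
rewrite !ler_norml => /andP[? _] /andP[_ ?]; lra.
Qed.

Lemma subball_trans f1 e1 f2 e2 f3 e3 :
  subball f1 e1 f2 e2 -> subball f2 e2 f3 e3 -> subball f1 e1 f3 e3.
Proof.
move=> [_ _ f12] [P3 e30 f23]; split => // x.
have := f12 x; have := f23 x; rewrite !ler_norml => /andP[? ?] /andP[? ?]; lra.
Qed.

(** P can be forced by shrinking balls. It is required of near-maximizers of the
    centre, rather than of maximizers of the members, in order to persist in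
    smaller balls. *)
Definition generic P : Prop := forall f e, Phi f -> 0 < e ->
  exists g d, subball f e g d /\
    forall x y, near_max g d x -> near_max g d y -> P (x, y).

Lemma genericT : generic setT.
Proof.
move=> f e Pf e0; exists f, e; split=> //; split=> // x.
by rewrite !subrr normr0.
Qed.

Lemma generic_sub P Q : P `<=` Q -> generic P -> generic Q.
Proof.
move=> PQ genP f e Pf e0; have [g [d [sub gP]]] := genP f e Pf e0.
by exists g, d; split => // x y gx gy; apply: PQ; exact: gP.
Qed.

(** The two requirements can be imposed in turn, because near-maximizers of the
    smaller ball are near-maximizers of the larger one. *)
Lemma genericI P Q : generic P -> generic Q -> generic (P `&` Q).
Proof.
move=> genP genQ f e Pf e0; have [g [d [sub gP]]] := genP f e Pf e0.
have [Pg d0 _] := sub; have [g' [d' [sub' gQ]]] := genQ g d Pg d0.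
exists g', d'; split; first exact: subball_trans sub sub'.
move=> x y gx gy; split; last exact: gQ.
by apply: gP; exact: (subball_near_max sub').
Qed.

(** Let z maximize h among the maximizers of f. Under the perturbation f + t h
    with t small, a near-maximizer x cannot have h x much above h z, since the
    points where h is that large are at a positive distance c below the maximum
    of f; nor can h x be much below h z, as z would then do better. *)
Lemma generic_flat h : Phi h -> generic [set p | h p.1 - h p.2 < 1].
Proof.
move=> Ph f e Pf e0; have [cf ch] := (Phi_continuous Pf, Phi_continuous Ph).
have [z0 z0max] := continuous_max K_nonempty K_compact cf.
have F0 : [set x | f z0 <= f x] !=set0 by exists z0 => /=.
have [z /= zf zh] := continuous_argmax K_compact ch F0 (closed_superlevel cf).
have fz x : f x <= f z by exact: le_trans (z0max x) zf.
have {}zh x : f z <= f x -> h x <= h z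
  by move=> zx; apply: zh; exact: le_trans zf zx.
have [c c0 gap] : exists2 c : R, 0 < c &
    forall x, h z + 2^-1 <= h x -> f x <= f z - c.
  have [Dne|D0] := pselect ([set x | h z + 2^-1 <= h x] !=set0); last first.
    by exists 1 => // x hx; exfalso; apply: D0; exists x.
  have [w /= hw wmax] := continuous_argmax K_compact cf Dne (closed_superlevel ch).
  exists (f z - f w); last by move=> x /wmax; rewrite subKr.
  rewrite subr_gt0 ltNge; apply/negP => /zh; lra.
set b := sup_norm h.
have hb x : - b <= h x <= b by rewrite -ler_norml; exact: abs_le_sup_norm.
have b0 : 0 <= b by have := hb z; lra.
(* with the new radius t / 4, this t keeps the perturbation within e, and the
   near-maximizers less than c below the maximum of f *)
pose t := Num.min e c / (4 * b + 4).
have t0 : 0 < t by rewrite divr_gt0 ?lt_min ?e0//; lra.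
have tb : 4 * (t * b) + 4 * t = Num.min e c.
  suff : t * (4 * b + 4) = Num.min e c by lra.
  by rewrite /t divfK// gt_eqF//; lra.
have tbe : 4 * (t * b) + 4 * t <= e by rewrite tb ge_min lexx.
have tbc : 4 * (t * b) + 4 * t <= c by rewrite tb ge_min lexx orbT.
have thb x : - (t * b) <= t * h x <= t * b.
  by rewrite -mulrN !ler_pM2l.
exists (fun x => t * h x + f x), (t / 4); split.
  split; [exact: Phi_linear|by rewrite divr_gt0|].
  move=> x; rewrite addrK ler_norml; have := thb x.
  have : 0 <= t * b by rewrite mulr_ge0// ltW.
  lra.
have near x : near_max (fun x => t * h x + f x) (t / 4) x ->
    h z - 2^-1 <= h x < h z + 2^-1.
  move=> /(_ z) /= nz; apply/andP; split.
    rewrite -(ler_pM2l t0); have := fz x; lra.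
  rewrite ltNge; apply/negP => /gap; have := thb x; have := thb z; lra.
move=> x y /near /andP[? ?] /near /andP[? ?] /=; lra.
Qed.

(** Otherwise the generic sets, restricted to the pairs at distance at least r,
    would generate a proper filter on the compact space K * K. It would cluster
    at a pair of distinct points, which some h in Phi separates, in
    contradiction with [generic_flat] for a large multiple of h. *)
Lemma generic_ball (r : R) : 0 < r -> generic [set p | ball p.1 r p.2].
Proof.
move=> r0; apply: contrapT => ngen.
set B := [set p : K * K | ball p.1 r p.2] in ngen.
pose G : set_system (K * K) := [set P | generic (P `|` B)].
have GF : ProperFilter G.
  split; first by rewrite /G /= set0U.
  split.
  - by rewrite /G /= setTU; exact: genericT.
  - by move=> P Q GP GQ; rewrite /G /= setUIl; exact: genericI.
  - by move=> P Q PQ; apply: generic_sub; exact: setSU.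
have KK : compact [set: K * K] by rewrite -setXTT; exact: compact_setX.
have [[x y] [_ clus]] := KK G GF filterT.
have xy : x <> y.
  move=> xy; have GB : G (~` B) by rewrite /G /= setUC setUv; exact: genericT.
  have r2 : 0 < r / 2 by rewrite divr_gt0.
  have nb : nbhs (x, y) (ball x (r / 2) `*` ball y (r / 2)).
    by exists (ball x (r / 2), ball y (r / 2)) => //; split; exact: nbhsx_ballx.
  have [[x' y'] [/= nB [xx' yy']]] := clus _ _ GB nb.
  apply: nB; rewrite /B /= (splitr r); apply: ball_triangle yy'.
  by rewrite -xy; exact: ball_sym.
have [h Ph hxy] := Phi_separates xy.
pose a := 2 / (h x - h y).
have Pah := Phi_scale a Ph.
have Gh : G [set p | a * h p.1 - a * h p.2 < 1].
  exact: generic_sub (@subsetUl _ _ _) (generic_flat Pah).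
have ahxy : a * h x - a * h y = 2.
  by rewrite -mulrBr divfK// subr_eq0; exact/eqP.
have nb : nbhs (x, y) [set p | 1 < a * h p.1 - a * h p.2].
  have cah := Phi_continuous Pah.
  exists ([set x' | a * h x - 2^-1 < a * h x'],
          [set y' | a * h y' < a * h y + 2^-1]); last first.
    move=> [x' y'] [/= ? ?]; lra.
  split => /=.
  - by apply: (cvgr_gt (a * h x) (cah x)); lra.
  - by apply: (cvgr_lt (a * h y) (cah y)); lra.
have [p [/= lt1 gt1]] := clus _ _ Gh nb.
by have := lt_trans gt1 lt1; rewrite ltxx.
Qed.

(** The centre g common to a decreasing sequence of balls, whose radii and whose
    near-maximizers shrink to nothing, has one maximizer. *)
Lemma exposing_dense f (e : R) : Phi f -> 0 < e ->
  exists g k, [/\ Phi g, forall x, `|g x - f x| <= e &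
    forall y, y <> k -> g y < g k].
Proof.
move=> Pf e0.
have inv0 n : 0 < n.+1%:R^-1 :> R by rewrite invr_gt0.
have step (np : nat * ((K -> R) * R)) : exists q : (K -> R) * R,
    Phi np.2.1 -> 0 < np.2.2 ->
    [/\ subball np.2.1 np.2.2 q.1 q.2, q.2 <= np.1.+1%:R^-1 &
      forall x y, near_max q.1 q.2 x -> near_max q.1 q.2 y ->
        ball x np.1.+1%:R^-1 y].
  case: np => n [f1 e1] /=.
  have [[P1 e10]|nP] := pselect (Phi f1 /\ 0 < e1); last first.
    by exists (f1, e1) => P1 e10; exfalso; exact: nP.
  have [g [d [[Pg d0 fg] gB]]] := generic_ball (inv0 n) P1 e10.
  pose d' := Num.min d n.+1%:R^-1.
  have d'd : d' <= d by rewrite ge_min lexx.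
  exists (g, d') => _ _; split => /=.
  - split=> // [|x]; first by rewrite lt_min d0 inv0.
    apply: le_trans (fg x) _; lra.
  - by rewrite ge_min lexx orbT.
  - by move=> x y gx gy; apply: gB => z; [have := gx z|have := gy z]; lra.
(* [s n] is the centre and the radius of the n-th ball *)
have [next nextP] := choice step.
pose s := fix s n := if n is m.+1 then next (m, s m) else (f, e).
have inv n : Phi (s n).1 /\ 0 < (s n).2.
  elim: n => [//|n [Pn n0]] /=.
  by have [[]] := nextP (n, s n) Pn n0.
have sP n := nextP (n, s n) (inv n).1 (inv n).2.
have nest n m x : (n <= m)%N ->
    `|(s m).1 x - (s n).1 x| <= (s n).2 - (s m).2.
  elim: m => [|m IH]; first by rewrite leqn0 => /eqP ->; rewrite !subrr normr0.
  rewrite leq_eqVlt => /predU1P[->|]; first by rewrite !subrr normr0.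
  rewrite ltnS => /IH; have [[_ _ fg] _ _] := sP m; have := fg x.
  rewrite -[next _]/(s m.+1) !ler_norml => /andP[? ?] /andP[? ?]; lra.
(* the intervals of centre [(s n).1 x] and radius [(s n).2] decrease with n, so
   the supremum of their left ends lies in all of them *)
pose g x := sup [set (s n).1 x - (s n).2 | n in [set: nat]].
have gs n x : `|g x - (s n).1 x| <= (s n).2.
  have up m : (s m).1 x - (s m).2 <= (s n).1 x + (s n).2.
    have [_ n0] := inv n; have [_ m0] := inv m.
    case: (leqP n m) => [|/ltnW] /(nest _ _ x); rewrite ler_norml => /andP[]; lra.
  rewrite ler_norml; apply/andP; split.
    rewrite lerBrDr addrC; apply: ub_le_sup; last by exists n.
    by exists ((s n).1 x + (s n).2) => _ [m _ <-].
  rewrite lerBlDr addrC; apply: ge_sup; last by move=> _ [m _ <-].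
  by exists ((s 0%N).1 x - (s 0%N).2), 0%N.
have Pg : Phi g.
  apply: Phi_uniform_limit => d d0.
  have [n nd] : exists n, n.+1%:R^-1 < d.
    have [n _ nP] := near_infty_natSinv_lt (PosNum d0).
    by exists n; exact: nP n (leqnn n).
  exists (s n.+1).1; first exact: (inv _).1.
  move=> x; apply: le_trans (gs _ _) _; have [_ + _] := sP n.
  by move=> /= le; exact: le_trans le (ltW nd).
have gmax z : (forall y, g y <= g z) -> forall n, near_max (s n).1 (s n).2 z.
  move=> zmax n y; have := gs n y; have := gs n z; have := zmax y.
  rewrite !ler_norml => ? /andP[? ?] /andP[? ?]; lra.
have [k kmax] := continuous_max K_nonempty K_compact (Phi_continuous Pg).
exists g, k; split=> // [|y yk]; first exact: gs 0%N.
rewrite ltNge; apply/negP => ky; apply: yk.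
have ymax x : g x <= g y := le_trans (kmax x) ky.
have yk n : ball y n.+1%:R^-1 k.
  by have [_ _] := sP n; apply; exact: (gmax _ _ n.+1).
apply: metric_hausdorff => U W /nbhs_ballP[d /= d0 dU] /nbhs_singleton Wk.
have [n _ nP] := near_infty_natSinv_lt (PosNum d0).
exists k; split => //; apply: dU; apply: le_ball (yk n).
by apply/ltW/nP => /=.
Qed.

(** * Norming sets and the Shilov boundary *)

Definition dominates A (l : (K -> R) -> R) : Prop :=
  forall f, Phi f -> forall c, (forall a, A a -> f a <= c) -> l f <= c.

Lemma exposed_dominates x : dominates (exposed Phi) (fun f => f x).
Proof.
move=> f Pf c fc; apply/ler_addgt0Pr => e e0.
have [g [k [Pg gf gk]]] := exposing_dense Pf (divr_gt0 e0 (ltr0n _ 2)).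
have fk : f k <= c by apply: fc; exists g.
have gxk : g x <= g k.
  by have [->//|xk] := pselect (x = k); exact/ltW/gk.
have := gf x; have := gf k; rewrite !ler_norml => /andP[? ?] /andP[? ?]; lra.
Qed.

Lemma exposed_nonempty : exposed Phi !=set0.
Proof.
have [g [k [Pg _ gk]]] := exposing_dense (Phi_constants 0) ltr01.
by exists k, g.
Qed.

Lemma exposed_norming : norming Phi (exposed Phi).
Proof.
move=> f Pf; have cf := Phi_continuous Pf.
set c := sup [set `|f x| | x in exposed Phi].
have kc k : exposed Phi k -> `|f k| <= c.
  by move=> ek; apply: ub_le_sup; [exact: has_ubound_abs|exists k].
have xc x : `|f x| <= c.
  rewrite ler_norml lerNl; apply/andP; split.
    apply: (@exposed_dominates x _ (Phi_opp Pf)) => k /kc.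
    by rewrite ler_norml lerNl => /andP[].
  by apply: (@exposed_dominates x _ Pf) => k /kc; rewrite ler_norml => /andP[].
apply/eqP; rewrite eq_le; apply/andP; split.
  have [x0 _] := K_nonempty.
  by apply: ge_sup => [|_ [x _ <-]]; [exists `|f x0|, x0|exact: xc].
have [k ek] := exposed_nonempty.
apply: ge_sup => [|_ [x _ <-]]; first by exists `|f k|, k.
exact: abs_le_sup_norm.
Qed.

Lemma closure_exposed_boundary : boundary Phi (closure (exposed Phi)).
Proof.
move=> f Pf; have cf := Phi_continuous Pf.
split; last by move=> _ [x _ <-]; exact: abs_le_sup_norm.
have [k ek] := exposed_nonempty.
have cabs : continuous (fun x => `|f x|).
  by move=> x; exact/continuous_comp/norm_continuous/cf.
have S0 : closure (exposed Phi) !=set0 by exists k; exact: subset_closure.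
have [z Sz zmax] :=
  continuous_argmax K_compact cabs S0 (@closed_closure _ (exposed Phi)).
exists z => //; apply/eqP; rewrite eq_le abs_le_sup_norm//=.
rewrite exposed_norming//; apply: ge_sup; first by exists `|f k|, k.
by move=> _ [x ex <-]; apply: zmax; exact: subset_closure.
Qed.

(** Adding the constant [sup_norm f] to a function f exposing k makes it
    nonnegative, so that its norm is attained at k only. *)
Lemma exposed_sub_boundary C : boundary Phi C -> exposed Phi `<=` C.
Proof.
move=> bC k [f Pf fk]; pose g x := 1 * f x + sup_norm f.
have Pg : Phi g by exact: Phi_linear Pf (Phi_constants _).
have fb x : - sup_norm f <= f x.
  have := abs_le_sup_norm K_nonempty K_compact x (Phi_continuous Pf).
  by rewrite ler_norml => /andP[].
have [[x Cx gx] _] := bC _ Pg.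
have [<-//|/fk xk] := pselect (x = k).
have := abs_le_sup_norm K_nonempty K_compact k (Phi_continuous Pg).
rewrite -gx leNgt !ger0_norm /g; have := fb x; have := fb k; first lra.
all: by move=> ? ?; lra.
Qed.

Lemma closure_exposed_Shilov : Shilov_boundary Phi (closure (exposed Phi)).
Proof.
have least C : closed C -> boundary Phi C -> closure (exposed Phi) `<=` C.
  move=> clC /exposed_sub_boundary /closure_subset eC.
  by rewrite (closure_id C).1.
split; first split.
- exact: closed_closure.
- exact: closure_exposed_boundary.
- by move=> C clC bC CE; apply/seteqP; split => //; exact: least.
- move=> C [clC bC Cmin]; apply/esym/Cmin; last exact: least.
    exact: closed_closure.
  exact: closure_exposed_boundary.
Qed.

(** * Extreme functionals *)

Definition linear_on_Phi (l : (K -> R) -> R) : Prop :=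
  forall (a : R) f g, Phi f -> Phi g ->
    l (fun x => a * f x + g x) = a * l f + l g.

Lemma linear_on_Phi_scale l (a : R) f : linear_on_Phi l -> Phi f ->
  l (fun x => a * f x) = a * l f.
Proof.
move=> llin Pf; have l0 : l (cst 0) = 0.
  have := llin (- 1) _ _ (Phi_constants 0) (Phi_constants 0).
  under [X in l X]eq_fun do rewrite /cst mulr0 addr0.
  by rewrite -[fun=> 0]/(cst 0); lra.
have := llin a _ _ Pf (Phi_constants 0).
by rewrite l0 addr0 => <-; congr l; apply/funext => x; rewrite addr0.
Qed.

Lemma linear_on_Phi_cst l (c : R) : linear_on_Phi l ->
  l (cst c) = c * l (cst 1).
Proof.
move=> llin; rewrite -linear_on_Phi_scale//; congr l.
by apply/funext => x; rewrite /cst mulr1.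
Qed.

Lemma linear_on_Phi_opp l f : linear_on_Phi l -> Phi f ->
  l (fun x => - f x) = - l f.
Proof.
move=> llin Pf; rewrite -mulN1r -linear_on_Phi_scale//; congr l.
by apply/funext => x; rewrite mulN1r.
Qed.

(** The unit ball of the dual, seen through functionals defined on all functions
    from K to R, whose values outside Phi are irrelevant. *)
Definition contraction (l : (K -> R) -> R) : Prop :=
  linear_on_Phi l /\ (forall f, Phi f -> `|l f| <= sup_norm f).

Lemma eval_contraction x : contraction (fun f => f x).
Proof.
by split=> // f Pf; exact/abs_le_sup_norm/Phi_continuous.
Qed.

Lemma contraction_unit_ball l : contraction l ->
  dual_unit_ball (fun f : set_type Phi => l (val f)).
Proof.
move=> [llin lle]; have Pval (f : set_type Phi) : Phi (val f).
  exact: set_mem (valP f).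
split; first split.
- move=> a f g h hE; have -> : val h = fun x => a * val f x + val g x.
    exact/funext.
  exact: llin.
- by exists 1 => f; rewrite mul1r; exact: lle.
- apply: ge_sup => [|_ [f /= f1 <-]]; last exact: le_trans (lle _ (Pval f)) f1.
  pose f0 : set_type Phi := exist _ (cst 0) (mem_set (Phi_constants 0)).
  exists `|l (val f0)|, f0 => //=; apply: ge_sup => [|_ [x _ <-]].
    by have [x0 _] := K_nonempty; exists `|val f0 x0|, x0.
  by rewrite normr0 ler01.
Qed.

Lemma sup_norm_ge0 f : continuous f -> 0 <= sup_norm f.
Proof.
move=> cf; have [x0 _] := K_nonempty.
exact: le_trans (normr_ge0 _) (abs_le_sup_norm K_nonempty K_compact x0 cf).
Qed.

Lemma sup_norm_scale_le (a : R) f : continuous f -> 0 <= a ->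
  sup_norm (fun x => a * f x) <= a * sup_norm f.
Proof.
move=> cf a0; have [x0 _] := K_nonempty.
apply: ge_sup => [|_ [x _ <-]]; first by exists `|a * f x0|, x0.
by rewrite normrM ger0_norm// ler_wpM2l// abs_le_sup_norm.
Qed.

(** The bound on [dual_norm] controls u on functions of norm at most 1, and
    scaling extends it to functions of positive norm; on functions of norm zero
    it is the boundedness of u that makes u vanish. *)
Lemma unit_ball_contraction (u : set_type Phi -> R^o) : dual_unit_ball u ->
  exists2 l, contraction l & u = fun f : set_type Phi => l (val f).
Proof.
move=> [[ulin [M uM]] u1].
have [l lE] : exists l : (K -> R) -> R, forall f : set_type Phi,
    l (val f) = u f.
  have ext (f : K -> R) : exists r : R,
      forall f' : set_type Phi, val f' = f -> u f' = r.
    have [Pf|nPf] := pselect (Phi f).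
      exists (u (exist _ f (mem_set Pf))) => f' f'E; congr u; exact/val_inj.
    exists 0 => f' f'E; exfalso; apply: nPf; rewrite -f'E.
    exact: set_mem (valP f').
  by have [l lP] := choice ext; exists l => f; rewrite (lP (val f) f).
pose lift f (Pf : Phi f) : set_type Phi := exist _ f (mem_set Pf).
have llin : linear_on_Phi l.
  move=> a f g Pf Pg; have := ulin a (lift _ Pf) (lift _ Pg)
    (lift _ (Phi_linear a Pf Pg)) (fun=> erefl).
  by rewrite -!lE.
exists l; last by apply/funext => f; rewrite lE.
split=> // f Pf; have cf := Phi_continuous Pf.
have lM g : Phi g -> `|l g| <= M * sup_norm g.
  by move=> Pg; have := uM (lift _ Pg); rewrite -lE.
have bnd : has_ubound [set `|u f| |
    f in [set f : set_type Phi | sup_norm (val f) <= 1]].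
  exists `|M| => _ [g /= g1 <-]; apply: le_trans (uM g) _.
  have g0 : 0 <= sup_norm (val g).
    by apply/sup_norm_ge0/Phi_continuous; exact: set_mem (valP g).
  apply: le_trans (ler_norm _) _; rewrite normrM (ger0_norm g0).
  by rewrite ler_piMr.
have := sup_norm_ge0 cf; rewrite le_eqVlt => /predU1P[f0|f0].
  by have := lM f Pf; rewrite -f0 mulr0.
have Pf' := Phi_scale (sup_norm f)^-1 Pf.
have : `|l (fun x => (sup_norm f)^-1 * f x)| <= 1.
  apply: le_trans u1; apply: ub_le_sup => //; exists (lift _ Pf').
    2: by rewrite -lE.
  apply: le_trans (sup_norm_scale_le cf _) _; first by rewrite invr_ge0 ltW.
  by rewrite mulVf// gt_eqF.
by rewrite linear_on_Phi_scale// normrM gtr0_norm ?invr_gt0// mulrC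
  ler_pdivrMr// mul1r.
Qed.

(** Exchanging l and m, and t and 1 - t, gives the conclusion for m as well. *)
Lemma Choquet_boundaryP x : Choquet_boundary Phi x <->
  forall (t : R) l m, 0 < t < 1 -> contraction l -> contraction m ->
    (forall f, Phi f -> f x = t * l f + (1 - t) * m f) ->
    forall f, Phi f -> l f = f x.
Proof.
have Pval (f : set_type Phi) : Phi (val f) by exact: set_mem (valP f).
split.
  move=> [_ ext] t l m t01 /contraction_unit_ball lB /contraction_unit_ball mB xlm.
  have [lx _ f Pf] := ext t _ _ t01 lB mB (funext (fun F => xlm _ (Pval F))).
  exact: (congr1 (fun u => u (exist _ f (mem_set Pf) : set_type Phi)) lx).
move=> ext; split; first exact: contraction_unit_ball (eval_contraction x).
move=> t _ _ t01 /unit_ball_contraction[l lC ->] /unit_ball_contraction[m mC ->].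
move=> xlm.
have xlm' f : Phi f -> f x = t * l f + (1 - t) * m f.
  move=> Pf.
  exact: (congr1 (fun u => u (exist _ f (mem_set Pf) : set_type Phi)) xlm).
split; apply/funext => f; first exact: ext t01 lC mC xlm' _ (Pval f).
apply: (ext (1 - t) m l) => //; first by lra.
by move=> g /xlm' ->; lra.
Qed.

Lemma dominates_contraction l :
  linear_on_Phi l -> dominates setT l -> contraction l.
Proof.
move=> llin ldom; split => // f Pf; have cf := Phi_continuous Pf.
have fb x : - sup_norm f <= f x <= sup_norm f.
  by rewrite -ler_norml; exact: abs_le_sup_norm.
rewrite ler_norml lerNl -linear_on_Phi_opp//; apply/andP; split.
  by apply: (ldom _ (Phi_opp Pf)) => x _; have := fb x; lra.
by apply: (ldom _ Pf) => x _; have := fb x; lra.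
Qed.

(** Functionals of norm 1 that take the value 1 at the constant 1 are positive:
    if g >= 0 then |b - 2 g| <= b for b the norm of g, so that
    b - 2 l g <= b. Here g is c - f. *)
Lemma state_dominates l : contraction l -> l (cst 1) = 1 -> dominates setT l.
Proof.
move=> [llin lle] l1 f Pf c fc.
have Pg := Phi_linear (- 1) Pf (Phi_constants c).
set g := (X in Phi X) in Pg.
have g0 x : 0 <= g x by have := fc x Logic.I; rewrite /g /cst; lra.
have gb x : g x <= sup_norm g.
  apply: le_trans (ler_norm _) _; apply: abs_le_sup_norm => //.
  exact: Phi_continuous.
have Ph := Phi_linear (- 2) Pg (Phi_constants (sup_norm g)).
set h := (X in Phi X) in Ph.
have hb : sup_norm h <= sup_norm g.
  have [x0 _] := K_nonempty.
  apply: ge_sup => [|_ [x _ <-]]; first by exists `|h x0|, x0.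
  have := g0 x; have := gb x; rewrite ler_norml /h [cst _ _]/=.
  by move=> ? ?; apply/andP; split; lra.
have lh : l h = - 2 * (c - l f) + sup_norm g.
  rewrite (llin _ _ _ Pg (Phi_constants _)) (llin _ _ _ Pf (Phi_constants _)).
  rewrite (linear_on_Phi_cst c)// (linear_on_Phi_cst (sup_norm _))// l1; lra.
by have := le_trans (lle _ Ph) hb; rewrite lh ler_norml => /andP[_]; lra.
Qed.

(** Only the points where g exceeds g k by at least e matter. They form a compact
    set avoiding k, on which f k - f has a positive lower bound. *)
Lemma peak_envelope f g k (e : R) : Phi f -> Phi g ->
  (forall y, y <> k -> f y < f k) -> 0 < e ->
  exists2 c : R, 0 <= c & forall x, c * f x + g x <= c * f k + g k + e.
Proof.
move=> Pf Pg fk e0; have [cf cg] := (Phi_continuous Pf, Phi_continuous Pg).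
have fkx x : f x <= f k.
  by have [->//|xk] := pselect (x = k); exact/ltW/fk.
have [Dne|D0] := pselect ([set x | g k + e <= g x] !=set0); last first.
  exists 0 => // x; rewrite !mul0r !add0r leNgt; apply/negP => gx.
  by apply: D0; exists x => /=; exact: ltW.
have [w /= gw wmax] := continuous_argmax K_compact cf Dne (closed_superlevel cg).
have fw : 0 < f k - f w.
  by rewrite subr_gt0; apply: fk => wk; move: gw; rewrite wk; lra.
have [z zmax] := continuous_max K_nonempty K_compact cg.
have gz : g k <= g z by [].
pose c := (g z - g k) / (f k - f w).
have c0 : 0 <= c by rewrite divr_ge0 ?subr_ge0// ltW.
exists c => // x; have [gx|gx] := leP (g k + e) (g x).
  have : c * (f k - f w) <= c * (f k - f x).
    by rewrite ler_wpM2l// lerD2l lerN2 wmax.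
  rewrite divfK ?gt_eqF//; have := zmax x; lra.
have := ler_wpM2l c0 (fkx x); lra.
Qed.

(** * Exposed points and the Choquet boundary *)

(** As l f <= f k and m f <= f k, with a mean equal to f k, both are equalities;
    applying l to the estimate of [peak_envelope] then gives l g <= g k. *)
Lemma exposed_sub_Choquet : exposed Phi `<=` Choquet_boundary Phi.
Proof.
move=> k [f Pf fk]; apply/Choquet_boundaryP => t l m /andP[t0 t1] lC mC klm.
have one1 n : contraction n -> n (cst 1) <= 1.
  move=> [_ /(_ _ (Phi_constants 1))]; have [x0 _] := K_nonempty.
  move=> /(le_trans (ler_norm _)) /le_trans; apply; apply: ge_sup.
    by eexists; exists x0.
  by move=> _ [x _ <-]; rewrite normr1.
have fkx x : f x <= f k.
  by have [->//|xk] := pselect (x = k); exact/ltW/fk.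
have [l1 m1] : l (cst 1) = 1 /\ m (cst 1) = 1.
  have := klm _ (Phi_constants 1); have := one1 _ lC; have := one1 _ mC.
  rewrite {3}/cst => ? ? ?; split; nra.
have lf : l f = f k.
  have lfk := state_dominates lC l1 Pf (fun x _ => fkx x).
  have mfk := state_dominates mC m1 Pf (fun x _ => fkx x).
  have := klm _ Pf; nra.
have lle g : Phi g -> l g <= g k.
  move=> Pg; apply/ler_addgt0Pr => e e0.
  have [c c0 cfg] := peak_envelope Pf Pg fk e0.
  have := state_dominates lC l1 (Phi_linear c Pf Pg) (fun x _ => cfg x).
  by rewrite lC.1// lf; lra.
move=> g Pg; apply/eqP; rewrite eq_le lle//=.
by have := lle _ (Phi_opp Pg); rewrite linear_on_Phi_opp ?lerN2//; case: lC.
Qed.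

(** The evaluation at x decomposes as l + (evaluation - l), with the mass
    [l (cst 1)] on A and the remaining mass on B. *)
Lemma dominates_split A B x : dominates (A `|` B) (fun f => f x) ->
  exists l, [/\ linear_on_Phi l,
    forall f c, Phi f -> (forall a, A a -> f a <= c) -> l f <= c * l (cst 1) &
    forall f c, Phi f -> (forall b, B b -> f b <= c) ->
      f x - l f <= c * (1 - l (cst 1))].
Proof.
move=> domAB.
(* a functional l is as wanted if l w + (h x - l h) <= c as soon as w <= c on A
   and h <= c on B; the change of w into w + h turns this into a bound on l w
   alone, with h and c existentially quantified *)
pose C : set ((K -> R^o) * R^o) := [set p | exists h (c : R), [/\ Phi h,
  forall a, A a -> p.1 a + h a <= c, forall b, B b -> h b <= c &
  c - h x <= p.2]].
have P0 : Phi (cst 0) := Phi_constants 0.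
have PD f g : Phi f -> Phi g -> Phi (fun x => f x + g x).
  by move=> Pf Pg; have := Phi_linear 1 Pf Pg; under eq_fun do rewrite mul1r.
have coneC : epigraph_cone C.
  split.
  - by exists (cst 0), 0; split => //= *; rewrite /cst /= ?addr0 ?subrr.
  - move=> p q [h [c [Ph hA hB hx]]] [h' [c' [Ph' hA' hB' hx']]].
    exists (fun x => h x + h' x), (c + c'); split; first exact: PD.
    + move=> a Aa; have := hA a Aa; have := hA' a Aa;
      by rewrite -[(p + q).1 a]/(p.1 a + q.1 a); lra.
    + move=> b Bb; have := hB b Bb; have := hB' b Bb; lra.
    + rewrite /=; lra.
  - move=> s p s0 [h [c [Ph hA hB hx]]].
    exists (fun x => s * h x), (s * c); split; first exact: Phi_scale.
    + by move=> a Aa; rewrite -mulrDr ler_pM2l// hA.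
    + by move=> b Bb; rewrite ler_pM2l// hB.
    + by rewrite -mulrBr ler_pM2l.
  - move=> r [h [c [Ph hA hB hx]]]; apply: le_trans hx; rewrite subr_ge0.
    apply: (domAB _ Ph) => y [/hA|/hB //]; by rewrite /= add0r.
have [||l [llin lC]] := linear_minorant (D := Phi) coneC.
- by move=> a v w Pv Pw; exact: Phi_linear.
- move=> v Pv; have [z zmax] :=
    continuous_max K_nonempty K_compact (Phi_continuous Pv).
  pose c := Num.max (v z) 0.
  exists c, (cst 0), c; split => //= [a _|b _|].
  + by rewrite /cst addr0 le_max zmax.
  + by rewrite /cst le_max lexx orbT.
  + by rewrite /cst subr0.
have {}llin : linear_on_Phi l by exact: llin.
exists l; split => // f c Pf fc.
  have Pg := Phi_linear 1 Pf (Phi_constants (- c)).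
  have : l (fun x => 1 * f x + cst (- c) x) <= 0.
    apply: lC => //; exists (cst 0), 0; split => //= a /fc; rewrite /cst; lra.
  by rewrite llin// (linear_on_Phi_cst (- c))//; lra.
have Pg := Phi_linear (- 1) Pf (Phi_constants c).
have Ph := Phi_linear 1 Pf (Phi_constants (- c)).
have : l (fun x => - 1 * f x + cst c x) <= c - f x.
  apply: lC => //; exists (fun x => 1 * f x + cst (- c) x), 0; split => //=.
  - by move=> a _; rewrite /cst; lra.
  - by move=> b /fc; rewrite /cst; lra.
  - by rewrite /cst; lra.
rewrite llin// (linear_on_Phi_cst c)//; lra.
Qed.

Lemma dominates_sub A B l : A `<=` B -> dominates A l -> dominates B l.
Proof. by move=> AB Al f Pf c fc; apply: Al => // a /AB; exact: fc. Qed.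

(** In [dominates_split] the parts of mass t and 1 - t, once normalized, are in
    the unit ball; extremality identifies the first one with the evaluation at x
    when 0 < t < 1, and a part of mass zero vanishes. *)
Lemma Choquet_dominates_prime A B x : Choquet_boundary Phi x ->
  dominates (A `|` B) (fun f => f x) ->
  dominates A (fun f => f x) \/ dominates B (fun f => f x).
Proof.
move=> /Choquet_boundaryP chx /dominates_split[l [llin lA lB]].
set t := l (cst 1) in lA lB.
have t0 : 0 <= t.
  have := lA (cst (- 1)) 0 (Phi_constants _) (fun _ _ => lerN10 _).
  by rewrite (linear_on_Phi_cst (- 1))// -/t; lra.
have t1 : t <= 1.
  have := lB (cst (- 1)) 0 (Phi_constants _) (fun _ _ => lerN10 _).
  by rewrite (linear_on_Phi_cst (- 1))// -/t /cst; lra.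
have fmax f : Phi f -> exists c, forall y, f y <= c.
  move=> /Phi_continuous cf; have [z zmax] := continuous_max K_nonempty K_compact cf.
  by exists (f z).
have [tz|tnz] := eqVneq t 0.
  right=> f Pf c fc; have := lB f c Pf fc; rewrite tz subr0 mulr1.
  have [c' c'P] := fmax _ Pf.
  by have := lA _ c' Pf (fun a _ => c'P a); rewrite tz mulr0; lra.
have [to|tno] := eqVneq t 1.
  left=> f Pf c fc; have := lA f c Pf fc; rewrite to mulr1.
  have [c' c'P] := fmax _ Pf.
  by have := lB _ c' Pf (fun a _ => c'P a); rewrite to subrr mulr0; lra.
have {}t0 : 0 < t by rewrite lt_def tnz.
have {}t1 : 0 < 1 - t by rewrite subr_gt0 lt_def eq_sym tno.
pose u f := t^-1 * l f; pose v f := (1 - t)^-1 * (f x - l f).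
have uA : dominates A u.
  by move=> f Pf c fc; rewrite /u ler_pdivrMl// mulrC lA.
have vB : dominates B v.
  by move=> f Pf c fc; rewrite /v ler_pdivrMl// mulrC lB.
have uC : contraction u.
  apply: dominates_contraction (dominates_sub (@subsetT _ A) uA).
  by move=> a f g Pf Pg; rewrite /u llin//; lra.
have vC : contraction v.
  apply: dominates_contraction (dominates_sub (@subsetT _ B) vB).
  by move=> a f g Pf Pg; rewrite /v llin//; lra.
left=> f Pf c fc; rewrite -(chx t u v _ uC vC _ _ Pf).
- exact: uA.
- by rewrite t0 -subr_gt0.
- by move=> g Pg; rewrite /u /v !mulVKf ?gt_eqF//; lra.
Qed.

(** A cluster point s of the filter F below is in the closure of the exposed
    points, since they are a member of F. If s differed from x, some function of
    Phi would be smaller, by a fixed amount, near s than at x. The exposed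
    points near s would then not dominate x: the complement of a neighbourhood
    of s would be a member of F. *)
Lemma Choquet_sub_closure_exposed :
  Choquet_boundary Phi `<=` closure (exposed Phi).
Proof.
move=> x chx.
pose dom A := dominates A (fun f => f x).
pose F : set_system K := [set A | ~ dom (exposed Phi `\` A)].
have FF : ProperFilter F.
  split; first by rewrite /F /= setD0; apply; exact: exposed_dominates.
  split.
  - rewrite /F /= setDT => /(_ _ (Phi_constants 0) (- 1)).
    by rewrite /cst => /(_ (fun _ => False_ind _)); rewrite ler0N1.
  - move=> A B FA FB; rewrite /F /= setDIr => AB.
    by have [/FA|/FB] := Choquet_dominates_prime chx AB.
  - move=> A B AB FA; rewrite /F /= => FB; apply: FA.
    by apply: dominates_sub FB; exact: setDS.
have [s [_ clus]] := K_compact FF filterT.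
have FE : F (exposed Phi).
  rewrite /F /= setDv => /(_ _ (Phi_constants 0) (- 1)).
  by rewrite /cst => /(_ (fun _ => False_ind _)); rewrite ler0N1.
suff <- : s = x by move=> U Us; exact: clus FE Us.
apply: contrapT => sx; have [h Ph hsx] := Phi_separates sx.
pose a := (h x - h s)^-1.
have Pah := Phi_scale a Ph.
have ahsx : a * h s = a * h x - 1.
  suff : a * (h x - h s) = 1 by rewrite mulrBr; lra.
  by rewrite mulVf// subr_eq0; apply/eqP => /esym.
pose U := [set y | a * h y < a * h x - 2^-1].
have Us : nbhs s U.
  by have cah := Phi_continuous Pah; apply: (cvgr_lt (a * h s) (cah s)); lra.
have FU : F (~` U).
  rewrite /F /= => /(_ _ Pah (a * h x - 2^-1)) Udom.
  suff : a * h x <= a * h x - 2^-1 by lra.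
  by apply: Udom => y [_ /= /contrapT/ltW].
by have [y [nUy Uy]] := clus _ _ FU Us.
Qed.

End FunctionSpace.

Theorem corollary8 (R : realType) (K : metricType R) (Phi : set (K -> R))
    (K_nonempty : [set: K] !=set0)
    (K_compact : compact [set: K])
    (Phi_closed_subspace : closed_subspace_of_CK Phi)
    (Phi_separates : separates_points Phi)
    (Phi_constants : contains_constants Phi) :
  norming Phi (exposed Phi) /\
  exists2 dPhi : set K, Shilov_boundary Phi dPhi &
    dPhi = closure (exposed Phi) /\
    closure (exposed Phi) = closure (Choquet_boundary Phi).
Proof.
split; first exact: exposed_norming.
exists (closure (exposed Phi)); first exact: closure_exposed_Shilov.
split => //; apply/seteqP; split; first exact/closure_subset/exposed_sub_Choquet.
rewrite [X in _ `<=` X](closure_id _).1; last exact: closed_closure.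
exact/closure_subset/Choquet_sub_closure_exposed.
Qed.
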